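(* Let $W=W(A,\alpha,u)$ be a generalized Weyl algebra, with $u$ central and regular in $A$, such that, for some fixed positive integer $m$, $M:=Au+A\alpha^m(u)$ is such that $A/M$ is a simple right Ore domain and $Au+A\alpha^i(u)=A$ for all positive integers $i\neq m$. Then the ring $W/J(M)$ has right Goldie rank $m$.
   Context: Given a ring $A$ (associative with $1$), an automorphism $\alpha$ of $A$ and a central element $u\in A$, the generalized Weyl algebra $W(A,\alpha,u)$ is the ring extension of $A$ generated by $X$ and $Y$ subject to the relations $YX=\alpha(u)$, $XY=u$ and, for all $a\in A$, $Ya=\alpha(a)Y$ and $Xa=\alpha^{-1}(a)X$. It is $\mathbb{Z}$-graded with degree $0$ component $A$ and, for $i>0$, degree $i$ component $AY^i$ and degree $-i$ component $AX^i$, each free of rank one as a left $A$-module. $J(M)$ denotes the $\mathbb{Z}$-graded ideal $J=\bigoplus_{i\in\mathbb{Z}}J_i$ of $W$ with, for $i\geq0$, $J_i=I_iY^i$ and $J_{-i}=I_{-i}X^i$, where $I_i=I_{-i}=A$ if $i\geq m$, and $I_i=\bigcap_{\ell=0}^{m-1-i}\alpha^{-\ell}(M)$, $I_{-i}=\bigcap_{\ell=i}^{m-1}\alpha^{-\ell}(M)$ if $0\leq i\leq m-1$ (this is indeed an ideal of $W$). The right Goldie rank of a ring is the uniform (Goldie) dimension of the ring as a right module over itself. *)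

(* Defs.v *)
From HB Require Import structures.
From mathcomp Require Import all_boot all_order all_algebra.
From mathcomp Require Import boolp classical_sets.
From mathcomp Require Import zify.

Set Implicit Arguments.
Unset Strict Implicit.
Unset Printing Implicit Defensive.

Import GRing.Theory.

Local Open Scope quotient_scope.
Local Open Scope classical_set_scope.
Local Open Scope ring_scope.

Record ideal (R : pzRingType) := Ideal {
  ideal_set :> set R;
  ideal0 : ideal_set 0;
  idealD : forall x y, ideal_set x -> ideal_set y -> ideal_set (x + y);
  idealMl : forall a x, ideal_set x -> ideal_set (a * x);
  idealMr : forall a x, ideal_set x -> ideal_set (x * a) }.

Section RingQuotient.
Variables (R : pzRingType) (I : ideal R).

Lemma idealN x : ideal_set I x -> ideal_set I (- x).
Proof. by move=> Ix; rewrite -mulN1r; apply: idealMl. Qed.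

Definition ideal_eq : rel R := fun x y => `[< ideal_set I (x - y) >].

Lemma ideal_eq_refl : reflexive ideal_eq.
Proof. by move=> x; apply/asboolP; rewrite subrr; apply: ideal0. Qed.

Lemma ideal_eq_sym : symmetric ideal_eq.
Proof.
by move=> x y; apply/asboolP/asboolP => /idealN; rewrite opprB.
Qed.

Lemma ideal_eq_trans : transitive ideal_eq.
Proof.
move=> y x z /asboolP Ixy /asboolP Iyz; apply/asboolP.
by rewrite -(subrK y x) -addrA; apply: idealD.
Qed.

Canonical ideal_equiv :=
  EquivRel ideal_eq ideal_eq_refl ideal_eq_sym ideal_eq_trans.

Definition ring_quot := {eq_quot ideal_equiv}.
HB.instance Definition _ := Choice.on ring_quot.
HB.instance Definition _ := Quotient.on ring_quot.

Definition rq_pi (x : R) : ring_quot := \pi_ring_quot x.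

Lemma rq_piP x y : rq_pi x = rq_pi y <-> ideal_set I (x - y).
Proof. by split=> [/eqmodP/asboolP|?] //; apply/eqmodP/asboolP. Qed.

Lemma rq_surj (q : ring_quot) : exists x, q = rq_pi x.
Proof. by exists (repr q); rewrite /rq_pi reprK. Qed.

Definition rq_add (p q : ring_quot) := rq_pi (repr p + repr q).
Definition rq_opp (p : ring_quot) := rq_pi (- repr p).
Definition rq_mul (p q : ring_quot) := rq_pi (repr p * repr q).

Lemma rq_repr x : ideal_set I (repr (rq_pi x) - x).
Proof. by apply/rq_piP; rewrite /rq_pi reprK. Qed.

Lemma rq_addE x y : rq_add (rq_pi x) (rq_pi y) = rq_pi (x + y).
Proof.
apply/rq_piP; rewrite opprD addrACA.
by apply: idealD; apply: rq_repr.
Qed.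

Lemma rq_oppE x : rq_opp (rq_pi x) = rq_pi (- x).
Proof. by apply/rq_piP; rewrite -opprD; apply/idealN/rq_repr. Qed.

Lemma rq_mulE x y : rq_mul (rq_pi x) (rq_pi y) = rq_pi (x * y).
Proof.
apply/rq_piP; set x' := repr _; set y' := repr _.
have -> : x' * y' - x * y = (x' - x) * y' + x * (y' - y).
  by rewrite mulrBl mulrBr addrA subrK.
by apply: idealD; [apply: idealMr|apply: idealMl]; apply: rq_repr.
Qed.

Let rq_ind (P : ring_quot -> Prop) : (forall x, P (rq_pi x)) -> forall q, P q.
Proof. by move=> Ppi q; have [x ->] := rq_surj q. Qed.

Fact rq_addA : associative rq_add.
Proof.
by elim/rq_ind=> x; elim/rq_ind=> y; elim/rq_ind=> z; rewrite !rq_addE addrA.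
Qed.
Fact rq_addC : commutative rq_add.
Proof. by elim/rq_ind=> x; elim/rq_ind=> y; rewrite !rq_addE addrC. Qed.
Fact rq_add0 : left_id (rq_pi 0) rq_add.
Proof. by elim/rq_ind=> x; rewrite rq_addE add0r. Qed.
Fact rq_addN : left_inverse (rq_pi 0) rq_opp rq_add.
Proof. by elim/rq_ind=> x; rewrite rq_oppE rq_addE addNr. Qed.
Fact rq_mulA : associative rq_mul.
Proof.
by elim/rq_ind=> x; elim/rq_ind=> y; elim/rq_ind=> z; rewrite !rq_mulE mulrA.
Qed.
Fact rq_mul1l : left_id (rq_pi 1) rq_mul.
Proof. by elim/rq_ind=> x; rewrite rq_mulE mul1r. Qed.
Fact rq_mul1r : right_id (rq_pi 1) rq_mul.
Proof. by elim/rq_ind=> x; rewrite rq_mulE mulr1. Qed.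
Fact rq_mulDl : left_distributive rq_mul rq_add.
Proof.
elim/rq_ind=> x; elim/rq_ind=> y; elim/rq_ind=> z.
by rewrite !(rq_addE, rq_mulE) mulrDl.
Qed.
Fact rq_mulDr : right_distributive rq_mul rq_add.
Proof.
elim/rq_ind=> x; elim/rq_ind=> y; elim/rq_ind=> z.
by rewrite !(rq_addE, rq_mulE) mulrDr.
Qed.

HB.instance Definition _ := GRing.isPzRing.Build ring_quot
  rq_addA rq_addC rq_add0 rq_addN rq_mulA rq_mul1l rq_mul1r rq_mulDl rq_mulDr.

Fact rq_pi_zmod : zmod_morphism rq_pi.
Proof. by move=> x y; rewrite /GRing.add/= /GRing.opp/= rq_oppE rq_addE. Qed.
Fact rq_pi_monoid : monoid_morphism rq_pi.
Proof. by split=> // x y; rewrite /GRing.mul/= rq_mulE. Qed.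

HB.instance Definition _ := GRing.isZmodMorphism.Build R ring_quot rq_pi rq_pi_zmod.
HB.instance Definition _ := GRing.isMonoidMorphism.Build R ring_quot rq_pi rq_pi_monoid.

End RingQuotient.

Definition central (R : pzRingType) (u : R) : Prop := forall a, a * u = u * a.

Definition regular (R : pzRingType) (u : R) : Prop := GRing.lreg u /\ GRing.rreg u.

Definition simple_ring (R : pzRingType) : Prop :=
  (1 : R) <> 0 /\ forall I : ideal R, I `<=` [set 0] \/ [set: R] `<=` I.

Definition is_domain (R : pzRingType) : Prop :=
  (1 : R) <> 0 /\ forall x y : R, x * y = 0 -> x = 0 \/ y = 0.

Definition right_ore_domain (R : pzRingType) : Prop :=
  is_domain R /\
  forall a s : R, s <> 0 -> exists b t : R, t <> 0 /\ a * t = s * b.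

Section UniformDimension.
Variables (R : pzRingType) (V : lmodType R).

Definition is_submodule (N : set V) : Prop :=
  [/\ N 0, forall x y, N x -> N y -> N (x + y) & forall (a : R) x, N x -> N (a *: x)].

Definition nonzero_submodule (N : set V) : Prop :=
  is_submodule N /\ exists2 x, N x & x <> 0.

Definition uniform_submodule (U : set V) : Prop :=
  nonzero_submodule U /\
  forall N1 N2, nonzero_submodule N1 -> nonzero_submodule N2 ->
    N1 `<=` U -> N2 `<=` U -> exists2 x, (N1 `&` N2) x & x <> 0.

Definition essential_submodule (E : set V) : Prop :=
  is_submodule E /\
  forall N, nonzero_submodule N -> exists2 x, (E `&` N) x & x <> 0.

Definition submodule_sum n (U : 'I_n -> set V) : set V :=
  [set x | exists2 c : 'I_n -> V, forall i, U i (c i) & x = \sum_(i < n) c i].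

Definition independent n (U : 'I_n -> set V) : Prop :=
  forall c : 'I_n -> V, (forall i, U i (c i)) -> \sum_(i < n) c i = 0 ->
  forall i, c i = 0.

(* V has an essential submodule that is a direct sum of n uniform ones. *)
Definition has_uniform_dim (n : nat) : Prop :=
  exists U : 'I_n -> set V,
    [/\ forall i, uniform_submodule (U i), independent U
      & essential_submodule (submodule_sum U)].

End UniformDimension.

(* A right R-module is a left module over the converse ring R^c; in (R^c)^o
   one has a *: x = x * a (product of R). *)
Definition has_right_goldie_rank (R : pzRingType) (n : nat) : Prop :=
  has_uniform_dim (R^c)^o n.

Record ring_aut (A : pzRingType) := RingAut {
  aut_fun :> {rmorphism A -> A};
  aut_inv : A -> A;
  aut_funK : cancel aut_fun aut_inv;
  aut_invK : cancel aut_inv aut_fun }.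

(* W(A, alpha, u) is the set of ring expressions in the elements of A and the
   letters X, Y, modulo the smallest congruence that contains the ring axioms,
   makes A -> W a unital ring morphism, and contains the defining relations. *)
Inductive gwa_term (A : Type) :=
  | GCst of A
  | GX
  | GY
  | GAdd of gwa_term A & gwa_term A
  | GOpp of gwa_term A
  | GMul of gwa_term A & gwa_term A.

Arguments GX {A}.
Arguments GY {A}.

HB.instance Definition _ (A : Type) := gen_eqMixin (gwa_term A).
HB.instance Definition _ (A : Type) := gen_choiceMixin (gwa_term A).

Section GWA.
Variables (A : pzRingType) (alpha : ring_aut A) (u : A).

Inductive gwa_cong : gwa_term A -> gwa_term A -> Prop :=
  | GC_refl s : gwa_cong s s
  | GC_sym s t : gwa_cong s t -> gwa_cong t s
  | GC_trans t s r : gwa_cong s t -> gwa_cong t r -> gwa_cong s r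
  | GC_add s s' t t' : gwa_cong s s' -> gwa_cong t t' ->
      gwa_cong (GAdd s t) (GAdd s' t')
  | GC_opp s s' : gwa_cong s s' -> gwa_cong (GOpp s) (GOpp s')
  | GC_mul s s' t t' : gwa_cong s s' -> gwa_cong t t' ->
      gwa_cong (GMul s t) (GMul s' t')
  | GC_addA s t r : gwa_cong (GAdd s (GAdd t r)) (GAdd (GAdd s t) r)
  | GC_addC s t : gwa_cong (GAdd s t) (GAdd t s)
  | GC_add0 s : gwa_cong (GAdd (GCst 0) s) s
  | GC_addN s : gwa_cong (GAdd (GOpp s) s) (GCst 0)
  | GC_mulA s t r : gwa_cong (GMul s (GMul t r)) (GMul (GMul s t) r)
  | GC_mul1l s : gwa_cong (GMul (GCst 1) s) s
  | GC_mul1r s : gwa_cong (GMul s (GCst 1)) s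
  | GC_mulDl s t r :
      gwa_cong (GMul (GAdd s t) r) (GAdd (GMul s r) (GMul t r))
  | GC_mulDr s t r :
      gwa_cong (GMul s (GAdd t r)) (GAdd (GMul s t) (GMul s r))
  | GC_cstD a b : gwa_cong (GCst (a + b)) (GAdd (GCst a) (GCst b))
  | GC_cstM a b : gwa_cong (GCst (a * b)) (GMul (GCst a) (GCst b))
  | GC_YX : gwa_cong (GMul GY GX) (GCst (alpha u))
  | GC_XY : gwa_cong (GMul GX GY) (GCst u)
  | GC_Y a : gwa_cong (GMul GY (GCst a)) (GMul (GCst (alpha a)) GY)
  | GC_X a : gwa_cong (GMul GX (GCst a)) (GMul (GCst (aut_inv alpha a)) GX).

Definition gwa_eq : rel (gwa_term A) := fun s t => `[< gwa_cong s t >].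

Lemma gwa_eq_refl : reflexive gwa_eq.
Proof. by move=> s; apply/asboolP; apply: GC_refl. Qed.

Lemma gwa_eq_sym : symmetric gwa_eq.
Proof. by move=> s t; apply/asboolP/asboolP; apply: GC_sym. Qed.

Lemma gwa_eq_trans : transitive gwa_eq.
Proof.
by move=> t s r /asboolP st /asboolP tr; apply/asboolP; apply: GC_trans st tr.
Qed.

Canonical gwa_equiv := EquivRel gwa_eq gwa_eq_refl gwa_eq_sym gwa_eq_trans.

Definition gwa := {eq_quot gwa_equiv}.
HB.instance Definition _ := Choice.on gwa.
HB.instance Definition _ := Quotient.on gwa.

Definition gwa_pi (s : gwa_term A) : gwa := \pi_gwa s.

Lemma gwa_piP s t : gwa_pi s = gwa_pi t <-> gwa_cong s t.
Proof. by split=> [/eqmodP/asboolP|?] //; apply/eqmodP/asboolP. Qed.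

Lemma gwa_surj (w : gwa) : exists s, w = gwa_pi s.
Proof. by exists (repr w); rewrite /gwa_pi reprK. Qed.

Definition gwa_add (v w : gwa) := gwa_pi (GAdd (repr v) (repr w)).
Definition gwa_opp (v : gwa) := gwa_pi (GOpp (repr v)).
Definition gwa_mul (v w : gwa) := gwa_pi (GMul (repr v) (repr w)).

Lemma gwa_repr s : gwa_cong (repr (gwa_pi s)) s.
Proof. by apply/gwa_piP; rewrite /gwa_pi reprK. Qed.

Lemma gwa_addE s t : gwa_add (gwa_pi s) (gwa_pi t) = gwa_pi (GAdd s t).
Proof. by apply/gwa_piP; apply: GC_add; apply: gwa_repr. Qed.

Lemma gwa_oppE s : gwa_opp (gwa_pi s) = gwa_pi (GOpp s).
Proof. by apply/gwa_piP; apply: GC_opp; apply: gwa_repr. Qed.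

Lemma gwa_mulE s t : gwa_mul (gwa_pi s) (gwa_pi t) = gwa_pi (GMul s t).
Proof. by apply/gwa_piP; apply: GC_mul; apply: gwa_repr. Qed.

Let gwa_ind0 (P : gwa -> Prop) : (forall s, P (gwa_pi s)) -> forall w, P w.
Proof. by move=> Ppi w; have [s ->] := gwa_surj w. Qed.

Fact gwa_addA : associative gwa_add.
Proof.
elim/gwa_ind0=> s; elim/gwa_ind0=> t; elim/gwa_ind0=> r.
by rewrite !gwa_addE; apply/gwa_piP; apply: GC_addA.
Qed.
Fact gwa_addC : commutative gwa_add.
Proof.
elim/gwa_ind0=> s; elim/gwa_ind0=> t.
by rewrite !gwa_addE; apply/gwa_piP; apply: GC_addC.
Qed.
Fact gwa_add0 : left_id (gwa_pi (GCst 0)) gwa_add.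
Proof.
by elim/gwa_ind0=> s; rewrite gwa_addE; apply/gwa_piP; apply: GC_add0.
Qed.
Fact gwa_addN : left_inverse (gwa_pi (GCst 0)) gwa_opp gwa_add.
Proof.
elim/gwa_ind0=> s; rewrite gwa_oppE gwa_addE.
by apply/gwa_piP; apply: GC_addN.
Qed.
Fact gwa_mulA : associative gwa_mul.
Proof.
elim/gwa_ind0=> s; elim/gwa_ind0=> t; elim/gwa_ind0=> r.
by rewrite !gwa_mulE; apply/gwa_piP; apply: GC_mulA.
Qed.
Fact gwa_mul1l : left_id (gwa_pi (GCst 1)) gwa_mul.
Proof.
by elim/gwa_ind0=> s; rewrite gwa_mulE; apply/gwa_piP; apply: GC_mul1l.
Qed.
Fact gwa_mul1r : right_id (gwa_pi (GCst 1)) gwa_mul.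
Proof.
by elim/gwa_ind0=> s; rewrite gwa_mulE; apply/gwa_piP; apply: GC_mul1r.
Qed.
Fact gwa_mulDl : left_distributive gwa_mul gwa_add.
Proof.
elim/gwa_ind0=> s; elim/gwa_ind0=> t; elim/gwa_ind0=> r.
by rewrite !(gwa_addE, gwa_mulE); apply/gwa_piP; apply: GC_mulDl.
Qed.
Fact gwa_mulDr : right_distributive gwa_mul gwa_add.
Proof.
elim/gwa_ind0=> s; elim/gwa_ind0=> t; elim/gwa_ind0=> r.
by rewrite !(gwa_addE, gwa_mulE); apply/gwa_piP; apply: GC_mulDr.
Qed.

HB.instance Definition _ := GRing.isPzRing.Build gwa
  gwa_addA gwa_addC gwa_add0 gwa_addN
  gwa_mulA gwa_mul1l gwa_mul1r gwa_mulDl gwa_mulDr.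

Definition gwa_cst (a : A) : gwa := gwa_pi (GCst a).
Definition gwaX : gwa := gwa_pi GX.
Definition gwaY : gwa := gwa_pi GY.

Fact gwa_cstD : {morph gwa_cst : a b / a + b}.
Proof.
by move=> a b; rewrite {2}/GRing.add/= gwa_addE; apply/gwa_piP; apply: GC_cstD.
Qed.

Fact gwa_cst_zmod : zmod_morphism gwa_cst.
Proof. by move=> a b; apply/(addIr (gwa_cst b)); rewrite -gwa_cstD !subrK. Qed.

Fact gwa_cst_monoid : monoid_morphism gwa_cst.
Proof.
split=> // a b; rewrite {2}/GRing.mul/= gwa_mulE.
by apply/gwa_piP; apply: GC_cstM.
Qed.

HB.instance Definition _ := GRing.isZmodMorphism.Build A gwa gwa_cst gwa_cst_zmod.
HB.instance Definition _ := GRing.isMonoidMorphism.Build A gwa gwa_cst gwa_cst_monoid.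

Lemma gwa_YX : gwaY * gwaX = gwa_cst (alpha u).
Proof. by rewrite /GRing.mul/= gwa_mulE; apply/gwa_piP; apply: GC_YX. Qed.

Lemma gwa_XY : gwaX * gwaY = gwa_cst u.
Proof. by rewrite /GRing.mul/= gwa_mulE; apply/gwa_piP; apply: GC_XY. Qed.

Lemma gwa_Ycst a : gwaY * gwa_cst a = gwa_cst (alpha a) * gwaY.
Proof. by rewrite /GRing.mul/= !gwa_mulE; apply/gwa_piP; apply: GC_Y. Qed.

Lemma gwa_Xcst a : gwaX * gwa_cst a = gwa_cst (aut_inv alpha a) * gwaX.
Proof. by rewrite /GRing.mul/= !gwa_mulE; apply/gwa_piP; apply: GC_X. Qed.

Lemma gwa_ind (P : gwa -> Prop) :
  (forall a, P (gwa_cst a)) -> P gwaX -> P gwaY ->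
  (forall v w, P v -> P w -> P (v + w)) -> (forall v, P v -> P (- v)) ->
  (forall v w, P v -> P w -> P (v * w)) -> forall w, P w.
Proof.
move=> Pc PX PY PD PN PM; elim/gwa_ind0; elim=> // [s Ps t Pt|s Ps|s Ps t Pt].
- by rewrite -gwa_addE; apply: PD.
- by rewrite -gwa_oppE; apply: PN.
- by rewrite -gwa_mulE; apply: PM.
Qed.

End GWA.

Arguments gwa_cst {A} alpha u a.
Arguments gwaX {A alpha u}.
Arguments gwaY {A alpha u}.

Section IdealM.
Variables (A : pzRingType) (alpha : ring_aut A) (u : A).

(* A u + A alpha^i(u) *)
Definition two_gen (i : nat) : set A :=
  [set x | exists a b : A, x = a * u + b * iter i alpha u].

Hypothesis uC : central u.

Lemma central_iter i : central (iter i alpha u).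
Proof.
elim: i => //= i IHi a; rewrite -(aut_invK alpha a) -!rmorphM.
by rewrite IHi.
Qed.

Fact two_gen0 i : two_gen i 0.
Proof. by exists 0, 0; rewrite !mul0r addr0. Qed.
Fact two_genD i x y : two_gen i x -> two_gen i y -> two_gen i (x + y).
Proof.
move=> [a [b ->]] [a' [b' ->]]; exists (a + a'), (b + b').
by rewrite !mulrDl addrACA.
Qed.
Fact two_genMl i c x : two_gen i x -> two_gen i (c * x).
Proof.
by move=> [a [b ->]]; exists (c * a), (c * b); rewrite mulrDr !mulrA.
Qed.
Fact two_genMr i c x : two_gen i x -> two_gen i (x * c).
Proof.
move=> [a [b ->]]; exists (a * c), (b * c).
by rewrite mulrDl -!mulrA uC central_iter.
Qed.

Definition gwaM (m : nat) : ideal A :=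
  Ideal (two_gen0 m) (@two_genD m) (@two_genMl m) (@two_genMr m).

End IdealM.

Arguments gwaM {A} alpha {u} uC m.

Section GradedJ.
Variables (A : pzRingType) (alpha : ring_aut A) (u : A) (m : nat) (M : set A).

(* alpha^{-l}(M) *)
Definition preM (l : nat) : set A := iter l (aut_inv alpha) @` M.

(* [Negz n] stands for the degree -(n+1). *)
Definition gwaI (i : int) : set A :=
  match i with
  | Posz n => if (m <= n)%N then setT
              else \bigcap_(l in [set l | (l <= m - 1 - n)%N]) preM l
  | Negz n => if (m <= n.+1)%N then setT
              else \bigcap_(l in [set l | (n.+1 <= l <= m - 1)%N]) preM l
  end.

Definition gwa_mon (i : int) : gwa alpha u :=
  match i with Posz n => gwaY ^+ n | Negz n => gwaX ^+ n.+1 end.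

Definition gwaJ_comp (i : int) : set (gwa alpha u) :=
  [set gwa_cst alpha u a * gwa_mon i | a in gwaI i].

Definition gwaJ_set : set (gwa alpha u) :=
  [set w | exists (s : seq int) (c : int -> gwa alpha u),
     [/\ uniq s, forall i, gwaJ_comp i (c i) & w = \sum_(i <- s) c i]].

Lemma preMP l a : preM l a <-> M (iter l alpha a).
Proof.
have K x : iter l alpha (iter l (aut_inv alpha) x) = x.
  by elim: l x => // l IHl x; rewrite iterS iterSr IHl aut_invK.
have K' x : iter l (aut_inv alpha) (iter l alpha x) = x.
  by elim: l x {K} => // l IHl x; rewrite iterS iterSr IHl aut_funK.
by split=> [[x Mx <-]|Ma]; [rewrite K|exists (iter l alpha a)].
Qed.

Lemma gwaI_posP n a :
  gwaI n%:Z a <-> forall l, (l + n < m)%N -> M (iter l alpha a).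
Proof.
rewrite /gwaI; case: leqP => mn; split=> //.
- by move=> _ l; rewrite ltnNge (leq_trans mn) ?leq_addl.
- by move=> Ia l lnm; apply/preMP/Ia => /=; rewrite leq_subRL ?leq_subRL; lia.
- by move=> Ia l /= lmn; apply/preMP/Ia; lia.
Qed.

Lemma gwaI_negP n a :
  gwaI (- n%:Z) a <-> forall l, (n <= l < m)%N -> M (iter l alpha a).
Proof.
case: n => [|n].
  rewrite oppr0 gwaI_posP.
  by split=> Ia l lm; apply: Ia; rewrite ?addn0 // in lm *.
rewrite -NegzE /gwaI; case: leqP => mn; split=> //.
- by move=> _ l; lia.
- by move=> Ia l lnm; apply/preMP/Ia => /=; lia.
- by move=> Ia l /= lmn; apply/preMP/Ia; lia.
Qed.

Lemma gwa_mon_neg n : gwa_mon (- n%:Z) = gwaX ^+ n.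
Proof. by case: n => [|n]; rewrite ?oppr0 // -NegzE. Qed.

Lemma gwa_Yncst n a :
  gwaY ^+ n * gwa_cst alpha u a = gwa_cst alpha u (iter n alpha a) * gwaY ^+ n.
Proof.
elim: n => [|n IHn]; first by rewrite mul1r mulr1.
by rewrite exprS -mulrA IHn !mulrA gwa_Ycst.
Qed.

Lemma gwa_Xncst n a :
  gwaX ^+ n * gwa_cst alpha u a =
    gwa_cst alpha u (iter n (aut_inv alpha) a) * gwaX ^+ n.
Proof.
elim: n => [|n IHn]; first by rewrite mul1r mulr1.
by rewrite exprS -mulrA IHn !mulrA gwa_Xcst.
Qed.

End GradedJ.

Section IdealJ.
Variables (A : pzRingType) (alpha : ring_aut A) (u : A).
Hypothesis uC : central u.
Variable m : nat.

Let M : ideal A := gwaM alpha uC m.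
Local Notation W := (gwa alpha u).
Local Notation cst := (gwa_cst alpha u).
Local Notation I := (gwaI alpha m M).
Local Notation mon := (gwa_mon alpha u).
Local Notation J := (@gwaJ_set A alpha u m M).
Local Notation Jc := (@gwaJ_comp A alpha u m M).

Let Mu : ideal_set M u.
Proof. by exists 1, 0; rewrite mul1r mul0r addr0. Qed.

Let Mmu : ideal_set M (iter m alpha u).
Proof. by exists 0, 1; rewrite mul1r mul0r add0r. Qed.

Let iter_aut0 l : iter l alpha 0 = 0.
Proof. by elim: l => //= l ->; rewrite rmorph0. Qed.

Let iter_autD l : {morph iter l alpha : x y / x + y}.
Proof. by move=> x y; elim: l => //= l ->; rewrite rmorphD. Qed.

Let iter_autM l : {morph iter l alpha : x y / x * y}.
Proof. by move=> x y; elim: l => //= l ->; rewrite rmorphM. Qed.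

Let iter_autK l x : iter l alpha (iter l (aut_inv alpha) x) = x.
Proof. by elim: l x => // l IHl x; rewrite iterS iterSr IHl aut_invK. Qed.

Let int_ind (P : int -> Prop) :
  (forall n, P (Posz n)) -> (forall n, P (- n.+1%:Z)) -> forall i, P i.
Proof. by move=> Pp Pn [n|n]; rewrite ?NegzE. Qed.

Let I0 i : I i 0.
Proof.
elim/int_ind: i => n.
- by apply/gwaI_posP => l _; rewrite iter_aut0; apply: ideal0.
- by apply/gwaI_negP => l _; rewrite iter_aut0; apply: ideal0.
Qed.

Let ID i x y : I i x -> I i y -> I i (x + y).
Proof.
elim/int_ind: i => n.
- move=> /gwaI_posP Ix /gwaI_posP Iy; apply/gwaI_posP => l ln.
  by rewrite iter_autD; apply: idealD; [apply: Ix|apply: Iy].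
- move=> /gwaI_negP Ix /gwaI_negP Iy; apply/gwaI_negP => l ln.
  by rewrite iter_autD; apply: idealD; [apply: Ix|apply: Iy].
Qed.

Let IMl i b x : I i x -> I i (b * x).
Proof.
elim/int_ind: i => n.
- move=> /gwaI_posP Ix; apply/gwaI_posP => l ln.
  by rewrite iter_autM; apply: idealMl; apply: Ix.
- move=> /gwaI_negP Ix; apply/gwaI_negP => l ln.
  by rewrite iter_autM; apply: idealMl; apply: Ix.
Qed.

Let IMr i b x : I i x -> I i (x * b).
Proof.
elim/int_ind: i => n.
- move=> /gwaI_posP Ix; apply/gwaI_posP => l ln.
  by rewrite iter_autM; apply: idealMr; apply: Ix.
- move=> /gwaI_negP Ix; apply/gwaI_negP => l ln.
  by rewrite iter_autM; apply: idealMr; apply: Ix.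
Qed.

Let Jc0 i : Jc i 0.
Proof. by exists 0; rewrite ?rmorph0 ?mul0r. Qed.

Let JcD i x y : Jc i x -> Jc i y -> Jc i (x + y).
Proof.
move=> [a Ia <-] [b Ib <-]; exists (a + b); first exact: ID.
by rewrite rmorphD mulrDl.
Qed.

Let JcMl i b x : Jc i x -> Jc i (cst b * x).
Proof.
move=> [a Ia <-]; exists (b * a); first exact: IMl.
by rewrite rmorphM mulrA.
Qed.

Let JcMr i b x : Jc i x -> Jc i (x * cst b).
Proof.
elim/int_ind: i => n [a Ia <-].
- exists (a * iter n alpha b); first exact: IMr.
  by rewrite rmorphM /= -!mulrA gwa_Yncst.
- exists (a * iter n.+1 (aut_inv alpha) b); first exact: IMr.
  by rewrite rmorphM -!mulrA !gwa_mon_neg gwa_Xncst.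
Qed.

Let shift_degD n : (n%:Z + 1)%R = n.+1%:Z. Proof. lia. Qed.
Let shift_degN n : (- n.+1%:Z + 1)%R = - n%:Z. Proof. lia. Qed.
Let shift_degB n : (n.+1%:Z - 1)%R = n%:Z. Proof. lia. Qed.
Let shift_degNB n : (- n%:Z - 1)%R = - n.+1%:Z. Proof. lia. Qed.

Let JcYl i x : Jc i x -> Jc (i + 1) (gwaY * x).
Proof.
elim/int_ind: i => n [a Ia <-]; rewrite mulrA gwa_Ycst.
- rewrite shift_degD; exists (alpha a); last by rewrite /= exprS mulrA.
  move/gwaI_posP: Ia => Ia; apply/gwaI_posP => l ln.
  by rewrite -iterSr; apply: Ia; lia.
- rewrite shift_degN; exists (alpha a * alpha u); last first.
    by rewrite !gwa_mon_neg exprS rmorphM /= -gwa_YX -!mulrA.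
  move/gwaI_negP: Ia => Ia; apply/gwaI_negP => l ln.
  rewrite iter_autM -!iterSr; have [<-|lm] := eqVneq m l.+1.
    exact: idealMl.
  by apply: idealMr; apply: Ia; lia.
Qed.

Let JcYr i x : Jc i x -> Jc (i + 1) (x * gwaY).
Proof.
elim/int_ind: i => n [a Ia <-].
- rewrite shift_degD; exists a; last by rewrite /= exprSr mulrA.
  by move/gwaI_posP: Ia => Ia; apply/gwaI_posP => l ln; apply: Ia; lia.
- rewrite shift_degN; exists (a * iter n (aut_inv alpha) u); last first.
    by rewrite !gwa_mon_neg exprSr rmorphM /= -!mulrA gwa_XY gwa_Xncst.
  move/gwaI_negP: Ia => Ia; apply/gwaI_negP => l ln.
  rewrite iter_autM; have [->|nl] := eqVneq l n.
    by apply: idealMl; rewrite iter_autK.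
  by apply: idealMr; apply: Ia; lia.
Qed.

Let JcXneg n x : Jc (- n%:Z) x ->
  Jc (- n.+1%:Z) (gwaX * x) /\ Jc (- n.+1%:Z) (x * gwaX).
Proof.
move=> [a /gwaI_negP Ia <-]; split.
- exists (aut_inv alpha a); last first.
    by rewrite !gwa_mon_neg exprS !mulrA gwa_Xcst.
  apply/gwaI_negP => -[|l] ln //.
  by rewrite iterSr aut_invK; apply: Ia; lia.
- exists a; last by rewrite !gwa_mon_neg exprSr !mulrA.
  by apply/gwaI_negP => l ln; apply: Ia; lia.
Qed.

Let JcXl i x : Jc i x -> Jc (i - 1) (gwaX * x).
Proof.
case: i => [[|n]|n].
- by move=> Jx; have [Jl Jr] := @JcXneg 0 x Jx.
- move=> [a Ia <-]; rewrite shift_degB.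
  exists (aut_inv alpha a * u); last first.
    by rewrite /= exprS rmorphM /= -gwa_XY !mulrA gwa_Xcst.
  move/gwaI_posP: Ia => Ia; apply/gwaI_posP => -[|l] ln.
    exact: idealMl.
  rewrite iter_autM iterSr aut_invK.
  by apply: idealMr; apply: Ia; lia.
- by rewrite NegzE shift_degNB => /JcXneg[].
Qed.

Let JcXr i x : Jc i x -> Jc (i - 1) (x * gwaX).
Proof.
case: i => [[|n]|n].
- by move=> Jx; have [Jl Jr] := @JcXneg 0 x Jx.
- move=> [a Ia <-]; rewrite shift_degB.
  exists (a * iter n alpha (alpha u)); last first.
    by rewrite /= exprSr rmorphM /= -!mulrA gwa_YX gwa_Yncst.
  move/gwaI_posP: Ia => Ia; apply/gwaI_posP => l ln.
  rewrite iter_autM -iterSr -iterD addnS.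
  have [lnm|lnm] := eqVneq (l + n).+1 m.
    by rewrite lnm; apply: idealMl.
  by apply: idealMr; apply: Ia; lia.
- by rewrite NegzE shift_degNB => /JcXneg[].
Qed.

Let J0 : J 0.
Proof. by exists [::], (fun=> 0); split=> //; rewrite big_nil. Qed.

Let JD x y : J x -> J y -> J (x + y).
Proof.
move=> [s [c [Us Jc_ ->]]] [t [d [Ut Jd ->]]].
pose ext (r : seq int) (e : int -> W) i := if i \in r then e i else 0.
have sumE r e q : uniq r -> uniq q -> {subset r <= q} ->
    \sum_(i <- r) e i = \sum_(i <- q) ext r e i.
  move=> Ur Uq rq; rewrite -big_mkcond -[RHS]big_filter; apply: perm_big.
  apply: uniq_perm => //; first exact: filter_uniq.
  by move=> i; rewrite mem_filter; case: (boolP (i \in r)) => // /rq ->.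
exists (undup (s ++ t)), (fun i => ext s c i + ext t d i); split.
- exact: undup_uniq.
- by move=> i; apply: JcD; rewrite /ext; case: ifP.
- rewrite big_split /=.
  by congr (_ + _); apply: sumE; rewrite ?undup_uniq // => i ir;
    rewrite mem_undup mem_cat ir ?orbT.
Qed.

Let Jc_J i x : Jc i x -> J x.
Proof.
move=> Jx; exists [:: i], (fun j => if j == i then x else 0); split=> //.
- by move=> j; case: eqP => [->|].
- by rewrite big_seq1 eqxx.
Qed.

Let J_ind (P : W -> Prop) : P 0 -> (forall x y, P x -> P y -> P (x + y)) ->
  (forall i x, Jc i x -> P x) -> forall x, J x -> P x.
Proof.
by move=> P0 PD PJ x [s [c [_ Jc_ ->]]]; elim/big_ind: _ => // i _; apply: PJ.
Qed.

Fact gwaJMl w x : J x -> J (w * x).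
Proof.
elim/gwa_ind: w x => [a|||v w Jv Jw|v Jv|v w Jv Jw] x.
- move: x; apply: J_ind => [|x y Jx Jy|i x Jx]; rewrite ?mulr0 ?mulrDr //; first exact: JD.
  exact: (Jc_J (JcMl _ Jx)).
- move: x; apply: J_ind => [|x y Jx Jy|i x Jx]; rewrite ?mulr0 ?mulrDr //; first exact: JD.
  exact: (Jc_J (JcXl Jx)).
- move: x; apply: J_ind => [|x y Jx Jy|i x Jx]; rewrite ?mulr0 ?mulrDr //; first exact: JD.
  exact: (Jc_J (JcYl Jx)).
- by move=> Jx; rewrite mulrDl; apply: JD; [apply: Jv|apply: Jw].
- move=> /Jv; rewrite mulNr.
  move: (v * x); apply: J_ind => [|y z Jy Jz|i y Jy]; rewrite ?oppr0 ?opprD //; first exact: JD.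
  by rewrite -mulN1r -(rmorphN1 cst); apply: (Jc_J (JcMl _ Jy)).
- by move=> /Jw/Jv; rewrite mulrA.
Qed.

Fact gwaJMr w x : J x -> J (x * w).
Proof.
elim/gwa_ind: w x => [a|||v w Jv Jw|v Jv|v w Jv Jw] x.
- move: x; apply: J_ind => [|x y Jx Jy|i x Jx]; rewrite ?mul0r ?mulrDl //; first exact: JD.
  exact: (Jc_J (JcMr _ Jx)).
- move: x; apply: J_ind => [|x y Jx Jy|i x Jx]; rewrite ?mul0r ?mulrDl //; first exact: JD.
  exact: (Jc_J (JcXr Jx)).
- move: x; apply: J_ind => [|x y Jx Jy|i x Jx]; rewrite ?mul0r ?mulrDl //; first exact: JD.
  exact: (Jc_J (JcYr Jx)).
- by move=> Jx; rewrite mulrDr; apply: JD; [apply: Jv|apply: Jw].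
- by move=> /Jv; rewrite mulrN -mulN1r; apply: gwaJMl.
- by move=> /Jv/Jw; rewrite mulrA.
Qed.

Definition gwaJ : ideal W := Ideal J0 JD gwaJMl gwaJMr.

End IdealJ.

Arguments gwaJ {A} alpha {u} uC m.

(* Main.v *)
Require Import Defs.
From HB Require Import structures.
From mathcomp Require Import all_boot all_order all_algebra.
From mathcomp Require Import boolp classical_sets.
From mathcomp Require Import zify.

(* Put D := A/M. The rule a |-> diag(pi(alpha^l(a)))_(0 <= l < m),
   Y |-> sum_l E_(l,l+1), X |-> sum_l pi(alpha^l(u)) E_(l,l-1) respects the
   relations of W because u and alpha^m(u) vanish in D, so it defines a
   representation W -> M_m(D). For 0 < l < m the central element pi(alpha^l(u))
   is a unit of D, as Au + A alpha^l(u) = A; hence the representation is onto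
   and its kernel, read off one diagonal at a time, is J(M). Thus W/J(M) is
   isomorphic to M_m(D), which is the direct sum of its m rows, and a row is
   uniform by the right Ore condition in D. *)

Set Implicit Arguments.
Unset Strict Implicit.
Unset Printing Implicit Defensive.

Import GRing.Theory.

Local Open Scope classical_set_scope.
Local Open Scope ring_scope.

(** * Transport of right Goldie rank along ring isomorphisms, and the first isomorphism theorem *)

Lemma nonzero_submodule_preim (R S : pzRingType) (f : {rmorphism R -> S})
    (N : set (S^c)^o) :
  (exists2 g, cancel f g & cancel g f) ->
  nonzero_submodule N -> nonzero_submodule (f @^-1` N : set (R^c)^o).
Proof.
move=> [g fK gK] [[N0 ND NZ] [x Nx x0]]; split.
  split=> [|y z Ny Nz|a y Ny] /=.
  - by rewrite /preimage /= rmorph0.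
  - by rewrite /preimage /= rmorphD; apply: ND.
  - by rewrite /preimage /= [f _](rmorphM f); apply: (NZ (f a)).
exists (g x) => [|gx0]; first by rewrite /preimage /= gK.
by apply: x0; rewrite -(gK x) gx0 rmorph0.
Qed.

(** An isomorphism identifies the right ideals of [R] with those of [S], so uniformity, independence
    and essentiality of the family [U] pass to its preimages under [f]. *)
Lemma right_goldie_rank_iso (R S : pzRingType) (f : {rmorphism R -> S}) n :
  bijective f -> has_right_goldie_rank S n -> has_right_goldie_rank R n.
Proof.
move=> [g fK gK] [U [Uu Ui [Us Ue]]].
pose gz := GRing.isZmodMorphism.Build S R g (can2_zmod_morphism fK gK).
pose gm := GRing.isMonoidMorphism.Build S R g (can2_monoid_morphism fK gK).
pose g' : {rmorphism S -> R} := HB.pack g gz gm.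
have preim (N : set (R^c)^o) : nonzero_submodule N ->
    nonzero_submodule (g @^-1` N : set (S^c)^o).
  by apply: (@nonzero_submodule_preim _ _ g'); exists f.
have preimf := @nonzero_submodule_preim _ _ f _ (ex_intro2 _ _ g fK gK).
have g_eq0 x : x <> 0 -> g x <> 0.
  by move=> x0 gx0; apply: x0; rewrite -(gK x) gx0 rmorph0.
have sumE (x : R) : submodule_sum U (f x) <->
    submodule_sum (fun i => f @^-1` U i : set (R^c)^o) x.
  split=> [[c Uc fx]|[c Uc ->]].
    exists (g \o c) => [i|]; first by rewrite /preimage /= gK.
    by rewrite -(fK x) fx; apply: (raddf_sum g').
  by exists (f \o c) => //; apply: (raddf_sum f).
exists (fun i => f @^-1` U i); split.
- move=> i; have [nzU UU] := Uu i; split; first exact: preimf.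
  move=> N1 N2 nz1 nz2 N1U N2U.
  have [||x [N1x N2x] x0] := UU _ _ (preim _ nz1) (preim _ nz2).
  - by move=> y /N1U; rewrite /preimage /= gK.
  - by move=> y /N2U; rewrite /preimage /= gK.
  by exists (g x); [|exact: g_eq0].
- move=> c Uc c0 i; rewrite -(fK (c i)).
  have -> : f (c i) = 0; last exact: (raddf0 g').
  apply: (Ui (f \o c)) => //=.
  by rewrite -[RHS](raddf0 f) -c0; apply/esym/(raddf_sum f).
- split.
    have [U0 UD UZ] := Us; split=> [|x y|a x].
    - by apply/sumE; rewrite rmorph0.
    - by move=> /sumE sx /sumE sy; apply/sumE; rewrite rmorphD; apply: UD.
    - by move=> /sumE sx; apply/sumE; rewrite [f _](rmorphM f); apply: (UZ (f a)).
  move=> N /preim/Ue[x [Ux Nx] x0]; exists (g x); last exact: g_eq0.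
  by split=> //; apply/sumE; rewrite gK.
Qed.

(** The induced map evaluates [f] at representatives: [repr (rq_pi I x)] and [x] differ by an
    element of the kernel, so the value depends on the class only. *)
Lemma ring_quot_iso (R S : pzRingType) (I : ideal R) (f : {rmorphism R -> S}) :
  (forall y, exists x, f x = y) -> (forall x, ideal_set I x <-> f x = 0) ->
  exists g : {rmorphism ring_quot I -> S}, bijective g.
Proof.
move=> f_surj kerf.
pose g (q : ring_quot I) := f (repr q).
have gpi x : g (rq_pi I x) = f x.
  by apply/eqP; rewrite -subr_eq0 -rmorphB; apply/eqP/kerf/rq_repr.
have gB : zmod_morphism g.
  move=> p q; have [x ->] := rq_surj p; have [y ->] := rq_surj q.
  by rewrite -rmorphB !gpi rmorphB.
have gM : monoid_morphism g.
  split=> [|p q]; first by rewrite -(rmorph1 (rq_pi I)) gpi rmorph1.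
  have [x ->] := rq_surj p; have [y ->] := rq_surj q.
  by rewrite -rmorphM !gpi rmorphM.
pose gz := GRing.isZmodMorphism.Build _ S g gB.
pose gm := GRing.isMonoidMorphism.Build _ S g gM.
pose g' : {rmorphism ring_quot I -> S} := HB.pack g gz gm.
exists g'; have [h hK] := choice f_surj.
exists (rq_pi I \o h) => [q|y] /=; last by rewrite gpi.
have [x ->] := rq_surj q; apply/rq_piP/kerf.
by rewrite rmorphB hK gpi subrr.
Qed.

(** * Goldie rank of a matrix ring over a right Ore domain *)

Section MatrixGoldieRank.
Variables (D : pzRingType) (n : nat).

Definition single_row (i : 'I_n) : set 'M[D]_n :=
  [set B | forall k j, k != i -> B k j = 0].

(** This column operation carries a chosen column to a chosen place; it serves to bring entries of
    two elements of one row to a common position. *)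
Lemma mul_delta_entry (B : 'M[D]_n) (j k : 'I_n) (d : D) r s :
  (B *m (d *: delta_mx j k)) r s = B r j * d *+ (s == k).
Proof.
rewrite mxE (bigD1 j) //= big1 => [|l /negPf lj]; rewrite !mxE ?eqxx ?lj /=.
  by case: (s == k); rewrite ?mulr1 ?mulr0 ?addr0 ?mulr0n.
by rewrite !mulr0.
Qed.

Lemma mx_neq0 (B : 'M[D]_n) : B <> 0 -> exists i j, B i j <> 0.
Proof.
move=> B0; apply: contrapT => nB; apply: B0; apply/matrixP => i j; rewrite mxE.
by apply: contrapT => Bij; apply: nB; exists i, j.
Qed.

(** Each row is a right ideal. Given nonzero elements [x] and [y] of row [i], pick a nonzero entry
    of each; column operations move suitable right multiples of these entries to position [(i, i)],
    where a common right multiple yields an element of both submodules. *)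
Lemma right_goldie_rank_matrix :
  right_ore_domain D -> has_right_goldie_rank 'M[D]_n n.
Proof.
move=> [[D10 Ddom] ore].
have rowS i : is_submodule (single_row i : set (('M[D]_n)^c)^o).
  split=> [k j _|x y Ux Uy k j ki|a x Ux k j ki]; first by rewrite mxE.
    by rewrite mxE Ux // Uy // addr0.
  (* Over the converse ring, scaling by [a] is right multiplication by [a], which acts within
     rows. *)
  rewrite [(_ *: _)](_ : _ = (x : 'M_n) *m a) // mxE big1 // => l _.
  by rewrite Ux ?mul0r.
exists single_row; split.
- move=> i; split.
    split=> //; exists (delta_mx i i).
      by move=> k j /negPf ki; rewrite mxE ki.
    by move=> /matrixP/(_ i i); rewrite !mxE !eqxx.
  move=> N1 N2 [[_ _ N1Z] [x N1x x0]] [[_ _ N2Z] [y N2y y0]] N1U N2U.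
  have [k [j xkj]] := mx_neq0 x0; have [k' [j' ykj]] := mx_neq0 y0.
  have Ek : k = i by apply: contra_notP xkj => /eqP; apply: N1U.
  have Ek' : k' = i by apply: contra_notP ykj => /eqP; apply: N2U.
  subst k k'.
  have [b [t [t0 xt]]] := ore (x i j) (y i j') ykj.
  exists ((x : 'M_n) *m (t *: delta_mx j i)); last first.
    (* The [(i, i)] entry is [x i j * t], a product of nonzero elements of a domain. *)
    move=> /matrixP/(_ i i); rewrite mul_delta_entry eqxx mulr1n mxE.
    by case/Ddom.
  split; first exact: (N1Z (t *: delta_mx j i)).
  have -> : (x : 'M_n) *m (t *: delta_mx j i) = y *m (b *: delta_mx j' i).
    apply/matrixP => r s; rewrite !mul_delta_entry.
    have [->|ri] := eqVneq r i; first by rewrite xt.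
    by rewrite (N1U _ N1x) // (N2U _ N2y) // !mul0r.
  exact: (N2Z (b *: delta_mx j' i)).
- move=> c Uc c0 i; apply/matrixP => r s.
  have [->|ri] := eqVneq r i; last by rewrite (Uc i) // mxE.
  move/matrixP/(_ i s): (c0); rewrite summxE (bigD1 i) //= big1 ?addr0 //.
  by move=> k ki; apply: (Uc k); rewrite eq_sym.
(* The rows add up to the whole ring, so essentiality is immediate. *)
- have sumT (x : 'M[D]_n) : submodule_sum (single_row : _ -> set (('M[D]_n)^c)^o) x.
    exists (fun i => \matrix_(r, s) (x r s *+ (r == i))).
      by move=> i k j /negPf ki; rewrite mxE ki.
    apply/matrixP => r s; rewrite summxE (bigD1 r) //= big1 => [|k kr].
      by rewrite mxE eqxx addr0.
    by rewrite mxE eq_sym (negPf kr).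
  split; first by split.
  by move=> N [_ [x Nx x0]]; exists x => //; split.
Qed.

End MatrixGoldieRank.

(** * The universal property of [W] *)

Lemma gwa_lift (A S : pzRingType) (alpha : ring_aut A) (u : A)
    (f : {rmorphism A -> S}) (x y : S) :
  y * x = f (alpha u) -> x * y = f u ->
  (forall a, y * f a = f (alpha a) * y) ->
  (forall a, x * f a = f (aut_inv alpha a) * x) ->
  exists g : {rmorphism gwa alpha u -> S},
    [/\ forall a, g (gwa_cst alpha u a) = f a, g gwaX = x & g gwaY = y].
Proof.
move=> yx xy yf xf.
pose fix ev (t : gwa_term A) : S := match t with
  | GCst a => f a | GX => x | GY => y
  | GAdd s t => ev s + ev t | GOpp s => - ev s | GMul s t => ev s * ev t
  end.
(* Evaluation respects the congruence by induction on its derivation: the ring axioms hold in [S],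
   and the defining relations are the hypotheses on [x] and [y]. *)
have evP s t : gwa_cong alpha u s t -> ev s = ev t.
  elim=> //= {s t}.
  - by move=> t s r _ -> _ ->.
  - by move=> s s' t t' _ -> _ ->.
  - by move=> s s' _ ->.
  - by move=> s s' t t' _ -> _ ->.
  - by move=> s t r; rewrite addrA.
  - by move=> s t; rewrite addrC.
  - by move=> s; rewrite rmorph0 add0r.
  - by move=> s; rewrite rmorph0 addNr.
  - by move=> s t r; rewrite mulrA.
  - by move=> s; rewrite rmorph1 mul1r.
  - by move=> s; rewrite rmorph1 mulr1.
  - by move=> s t r; rewrite mulrDl.
  - by move=> s t r; rewrite mulrDr.
  - by move=> a b; rewrite rmorphD.
  - by move=> a b; rewrite rmorphM.
pose g (w : gwa alpha u) := ev (repr w).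
have gpi s : g (gwa_pi alpha u s) = ev s by apply/evP/gwa_repr.
have gB : zmod_morphism g.
  move=> v w; have [s ->] := gwa_surj v; have [t ->] := gwa_surj w.
  by rewrite {1}/GRing.add/= {1}/GRing.opp/= gwa_oppE gwa_addE !gpi.
have gM : monoid_morphism g.
  split=> [|v w]; first by rewrite gpi /= rmorph1.
  have [s ->] := gwa_surj v; have [t ->] := gwa_surj w.
  by rewrite {1}/GRing.mul/= gwa_mulE !gpi.
pose gz := GRing.isZmodMorphism.Build _ S g gB.
pose gm := GRing.isMonoidMorphism.Build _ S g gM.
pose g' : {rmorphism gwa alpha u -> S} := HB.pack g gz gm.
by exists g'; split=> [a||]; apply: gpi.
Qed.

Definition invertible (R : pzRingType) (x : R) : Prop :=
  exists y, x * y = 1 /\ y * x = 1.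

Lemma invertible1 (R : pzRingType) : invertible (1 : R).
Proof. by exists 1; rewrite mulr1. Qed.

Lemma invertibleM (R : pzRingType) (x y : R) :
  invertible x -> invertible y -> invertible (x * y).
Proof.
move=> [x' [xx' x'x]] [y' [yy' y'y]]; exists (y' * x'); split.
  by rewrite mulrA -(mulrA x) yy' mulr1.
by rewrite mulrA -(mulrA y') x'x mulr1.
Qed.

(** * The matrix representation of [W] over [D] *)

Section MatrixRepresentation.
Variables (A : pzRingType) (alpha : ring_aut A) (u : A) (uC : central u).
Variable m : nat.

Local Notation M := (gwaM alpha uC m).
Local Notation D := (ring_quot M).
Local Notation W := (gwa alpha u).
Local Notation cst := (gwa_cst alpha u).
Local Notation mon := (gwa_mon alpha u).

Definition twist (l : nat) (a : A) : D := rq_pi M (iter l alpha a).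

Fact twist_zmod l : zmod_morphism (twist l).
Proof.
move=> a b; rewrite -rmorphB; congr rq_pi.
by elim: l => //= l ->; rewrite rmorphB.
Qed.

Fact twist_monoid l : monoid_morphism (twist l).
Proof.
split=> [|a b]; rewrite /twist.
  rewrite -(rmorph1 (rq_pi M)); congr rq_pi.
  by elim: l => //= l ->; rewrite rmorph1.
rewrite -rmorphM; congr rq_pi.
by elim: l => //= l ->; rewrite rmorphM.
Qed.

HB.instance Definition _ l := GRing.isZmodMorphism.Build A D (twist l) (twist_zmod l).
HB.instance Definition _ l := GRing.isMonoidMorphism.Build A D (twist l) (twist_monoid l).

Lemma twist_eq0 l a : twist l a = 0 <-> ideal_set M (iter l alpha a).
Proof. by rewrite -(rmorph0 (rq_pi M)) rq_piP subr0. Qed.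

Lemma twistS l a : twist l.+1 a = twist l (alpha a).
Proof. by rewrite /twist iterSr. Qed.

Lemma twist0_u : twist 0 u = 0.
Proof. by apply/twist_eq0; exists 1, 0; rewrite mul1r mul0r addr0. Qed.

Lemma twistm_u : twist m u = 0.
Proof. by apply/twist_eq0; exists 0, 1; rewrite mul1r mul0r add0r. Qed.

Lemma twist_u_comm l (d : D) : d * twist l u = twist l u * d.
Proof.
have [a ->] := rq_surj d.
by rewrite /twist -!rmorphM (central_iter alpha uC).
Qed.

(** Write [1 = a u + b alpha^l(u)]. The first term dies in [D], so the class of [b] is a left
    inverse, and centrality makes it two-sided. *)
Lemma twist_u_invertible l :
  two_gen alpha u l = [set: A] -> invertible (twist l u).
Proof.
move=> ul; have [a [b ab]] : two_gen alpha u l 1 by rewrite ul.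
have bu : rq_pi M b * twist l u = 1.
  have /(congr1 (rq_pi M)) := ab.
  by rewrite rmorphD !rmorphM rmorph1 /= -[rq_pi M u]/(twist 0 u) twist0_u mulr0 add0r.
by exists (rq_pi M b); rewrite -twist_u_comm.
Qed.

Definition diag_twist (a : A) : 'M[D]_m :=
  \matrix_(i, j) (twist i a *+ (i == j)).

Definition matX : 'M[D]_m := \matrix_(i, j) (twist i u *+ (i == j.+1 :> nat)).
Definition matY : 'M[D]_m := \matrix_(i, j) ((j == i.+1 :> nat)%:R).

Lemma diag_twist_mul a (B : 'M[D]_m) i j :
  (diag_twist a *m B) i j = twist i a * B i j.
Proof.
rewrite mxE (bigD1 i) //= big1 ?mxE ?eqxx ?addr0 // => k /negPf ki.
by rewrite mxE eq_sym ki mul0r.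
Qed.

Fact diag_twist_zmod : zmod_morphism diag_twist.
Proof.
by move=> a b; apply/matrixP => i j; rewrite !mxE rmorphB mulrnBl.
Qed.

Fact diag_twist_monoid : monoid_morphism diag_twist.
Proof.
split=> [|a b]; apply/matrixP => i j; first by rewrite !mxE rmorph1.
by rewrite [RHS]diag_twist_mul !mxE rmorphM mulrnAr.
Qed.

HB.instance Definition _ :=
  GRing.isZmodMorphism.Build A 'M[D]_m diag_twist diag_twist_zmod.
HB.instance Definition _ :=
  GRing.isMonoidMorphism.Build A 'M[D]_m diag_twist diag_twist_monoid.

Lemma matY_mulS (i k : 'I_m) (B : 'M[D]_m) j : k = i.+1 :> nat -> (matY *m B) i j = B k j.
Proof.
move=> ki; rewrite mxE (bigD1 k) //= big1 ?mxE ?ki ?eqxx ?mul1r ?addr0 // => l.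
by rewrite mxE -val_eqE /= ki => /negPf ->; rewrite mul0r.
Qed.

Lemma matY_mul_last (i : 'I_m) (B : 'M[D]_m) j : i.+1 = m -> (matY *m B) i j = 0.
Proof.
move=> im; rewrite mxE big1 // => k _.
by rewrite mxE im (negPf (_ : k != m :> nat)) ?mul0r // neq_ltn ltn_ord.
Qed.

Lemma matX_mulS (i k : 'I_m) (B : 'M[D]_m) j :
  i = k.+1 :> nat -> (matX *m B) i j = twist i u * B k j.
Proof.
move=> ik; rewrite mxE (bigD1 k) //= big1 ?mxE ?ik ?eqxx ?addr0 // => l.
by rewrite mxE -val_eqE /= ik eqSS eq_sym => /negPf ->; rewrite mul0r.
Qed.

Lemma matX_mul_first (i : 'I_m) (B : 'M[D]_m) j : i = 0 :> nat -> (matX *m B) i j = 0.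
Proof. by move=> i0; rewrite mxE big1 // => k _; rewrite mxE i0 mul0r. Qed.

Lemma ord_succP (i : 'I_m) : i.+1 = m \/ exists k : 'I_m, k = i.+1 :> nat.
Proof.
have := ltn_ord i; rewrite leq_eqVlt => /orP[/eqP|im]; first by left.
by right; exists (Ordinal im).
Qed.

Lemma ord_predP (i : 'I_m) : i = 0 :> nat \/ exists k : 'I_m, i = k.+1 :> nat.
Proof.
case: i => -[|i] im; first by left.
by right; exists (Ordinal (ltnW im)).
Qed.

(** Both sides are diagonal with entries [twist i.+1 u]. The last row of the product is zero, which
    agrees because [alpha^m(u)] lies in [M]. *)
Lemma matYX : matY * matX = diag_twist (alpha u).
Proof.
apply/matrixP => i j; rewrite [diag_twist _ _ _]mxE -twistS.
have [im|[k ki]] := ord_succP i.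
  by rewrite [LHS]matY_mul_last // im twistm_u mul0rn.
by rewrite [LHS](matY_mulS _ _ ki) mxE ki eqSS.
Qed.

(** Here it is the first row of the product that is zero, in agreement with [u] lying in [M]. *)
Lemma matXY : matX * matY = diag_twist u.
Proof.
apply/matrixP => i j; rewrite [diag_twist _ _ _]mxE.
have [i0|[k ik]] := ord_predP i.
  by rewrite [LHS]matX_mul_first // i0 twist0_u mul0rn.
by rewrite [LHS](matX_mulS _ _ ik) mxE -ik mulr_natr eq_sym.
Qed.

Lemma matY_diag a : matY * diag_twist a = diag_twist (alpha a) * matY.
Proof.
apply/matrixP => i j; rewrite [RHS]diag_twist_mul -twistS.
rewrite [matY _ _]mxE mulr_natr; have [im|[k ki]] := ord_succP i.
  by rewrite [LHS]matY_mul_last // im ltn_eqF.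
by rewrite [LHS](matY_mulS _ _ ki) mxE -ki eq_sym.
Qed.

Lemma matX_diag a : matX * diag_twist a = diag_twist (aut_inv alpha a) * matX.
Proof.
apply/matrixP => i j; rewrite [RHS]diag_twist_mul.
rewrite [matX _ _]mxE; have [i0|[k ik]] := ord_predP i.
  by rewrite [LHS]matX_mul_first // i0 mulr0.
(* The coefficient [twist i u] of [matX] must pass across the image of [a], which its centrality in
   [D] allows. *)
rewrite [LHS](matX_mulS _ _ ik) mxE ik eqSS !mulrnAr twist_u_comm.
by rewrite [twist k.+1 (aut_inv _ _)]twistS aut_invK.
Qed.

(** * Homogeneous components of [W] as diagonals of matrices *)

Lemma matY_exp n i j : (matY ^+ n) i j = (j == i + n :> nat)%N%:R.
Proof.
elim: n i => [|n IHn] i; first by rewrite expr0 mxE addn0 eq_sym.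
rewrite exprS; have [im|[k ki]] := ord_succP i.
  by rewrite [LHS]matY_mul_last // addnS -addSn im ltn_eqF // ltn_addr.
by rewrite [LHS](matY_mulS _ _ ki) IHn ki addnS.
Qed.

Hypothesis u_inv :
  forall l, (0 < l)%N -> l <> m -> two_gen alpha u l = [set: A].

(** A nonzero entry is the product of the [twist l u] for [j < l <= i], where [i = j + n]; each such
    [l] lies strictly between [0] and [m], so every factor is a unit. *)
Lemma matX_exp n i : exists2 v, invertible v &
  forall j, (matX ^+ n) i j = v *+ (i == j + n :> nat)%N.
Proof.
elim: n i => [|n IHn] i.
  by exists 1 => [|j]; [exact: invertible1|rewrite expr0 mxE addn0].
have [i0|[k ik]] := ord_predP i.
  (* Row [0] of a positive power vanishes, so any unit will do. *)
  exists 1 => [|j]; first exact: invertible1.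
  by rewrite exprS [LHS]matX_mul_first // i0 addnS.
have [v vU vE] := IHn k; exists (twist i u * v) => [|j].
  apply: invertibleM => //; apply/twist_u_invertible/u_inv; first by rewrite ik.
  by apply/eqP; rewrite ltn_eqF.
by rewrite exprS [LHS](matX_mulS _ _ ik) vE mulrnAr ik addnS eqSS.
Qed.

(** The rows [i] met by the diagonal [j - i = k] are exactly the exponents in the intersection
    defining [I_k]. For [|k| >= m] that diagonal is empty, matching [I_k = A]. *)
Lemma gwaI_twist k a :
  gwaI alpha m M k a <->
  forall i j : 'I_m, j%:Z - i%:Z = k -> twist i a = 0.
Proof.
case: k => n; rewrite ?NegzE (gwaI_posP, gwaI_negP); split.
- by move=> Ia i j ij; apply/twist_eq0/Ia; have := ltn_ord j; lia.
- move=> Ia l lm; apply/twist_eq0.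
  have lm' : (l < m)%N by lia.
  by apply: (Ia (Ordinal lm') (Ordinal lm)) => /=; lia.
- by move=> Ia i j ij; apply/twist_eq0/Ia; have := ltn_ord i; lia.
- move=> Ia l lm; apply/twist_eq0.
  have lm' : (l < m)%N by lia.
  have lnm : (l - n.+1 < m)%N by lia.
  by apply: (Ia (Ordinal lm') (Ordinal lnm)) => /=; lia.
Qed.

(** * Kernel and image of the representation *)

Section Kernel.
Variable g : {rmorphism W -> 'M[D]_m}.
Hypotheses (g_cst : forall a, g (cst a) = diag_twist a).
Hypotheses (gX : g gwaX = matX) (gY : g gwaY = matY).

(** Degree [k] lands on the [k]-th diagonal, and the factor [v] is a unit, so vanishing of an entry
    depends on [twist i a] alone. *)
Lemma rep_mon k i : exists2 v, invertible v &
  forall a j, g (cst a * mon k) i j = twist i a * v *+ (j%:Z - i%:Z == k).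
Proof.
have gE a x j : g (cst a * x) i j = twist i a * g x i j.
  by rewrite rmorphM g_cst [LHS]diag_twist_mul.
case: k => n.
  exists 1 => [|a j]; first exact: invertible1.
  rewrite gE rmorphXn /= gY matY_exp mulr1 mulr_natr.
  by congr (_ *+ nat_of_bool _); lia.
have [v vU vE] := matX_exp n.+1 i; exists v => // a j.
rewrite gE rmorphXn /= gX vE mulrnAr.
by congr (_ *+ nat_of_bool _); lia.
Qed.

Lemma rep_mon_eq0 k a : gwaI alpha m M k a <-> g (cst a * mon k) = 0.
Proof.
rewrite gwaI_twist; split=> [Ia|/matrixP gak i j ij].
  apply/matrixP => i j; have [v _ ->] := rep_mon k i; rewrite [RHS]mxE.
  by case: eqP => // /Ia ->; rewrite mul0r.
have [v [w [vw _]] vE] := rep_mon k i.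
have := gak i j; rewrite vE ij eqxx mulr1n mxE => /(congr1 ( *%R^~ w)).
by rewrite -mulrA vw mulr1 mul0r.
Qed.

(* J for m = 0 contains 1, so it is all of W. *)
Lemma gwa_homogeneous_sum (w : W) : exists (s : seq int) (c : int -> A),
  uniq s /\ w = \sum_(k <- s) cst (c k) * mon k.
Proof.
have J01 : ideal_set (gwaJ alpha uC 0) 1.
  exists [:: 0], (fun k => if k == 0 then 1 else 0); split=> [//|k|].
    case: eqP => [->|_]; first by exists 1; rewrite ?rmorph1 ?mul1r.
    exists 0; last by rewrite rmorph0 mul0r.
    by case: k => k.
  by rewrite big_seq1 eqxx.
have := @idealMl _ _ w _ J01; rewrite mulr1 => -[s [c [us Jc ->]]].
have [d dE] := choice (fun k => let: ex_intro2 a _ ca := Jc k in ex_intro _ a ca).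
by exists s, d; split=> //; apply: eq_bigr => k _; rewrite dE.
Qed.

(** Distinct degrees occupy disjoint diagonals, so an element is killed only if each of its
    homogeneous terms is. *)
Lemma rep_kernel w : ideal_set (gwaJ alpha uC m) w <-> g w = 0.
Proof.
split=> [[s [c [_ Jc ->]]]|].
  rewrite rmorph_sum big1 // => k _.
  by have [a /rep_mon_eq0 ga <-] := Jc k.
have [s [c [us ->]]] := gwa_homogeneous_sum w.
rewrite rmorph_sum => /matrixP g0.
(* The family must lie in [J] in every degree, so it is set to zero outside [s]. *)
exists s, (fun k => if k \in s then cst (c k) * mon k else 0); split=> // [k|].
  case: ifPn => ks; last first.
    exists 0; last by rewrite rmorph0 mul0r.
    by apply/rep_mon_eq0; rewrite rmorph0 mul0r rmorph0.
  exists (c k) => //; apply/rep_mon_eq0/matrixP => i j; rewrite [RHS]mxE.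
  have [v _ vE] := rep_mon k i; rewrite vE.
  case: eqP => // ij; rewrite mulr1n.
  (* At a position with [j - i = k] only the term of degree [k] contributes. *)
  have := g0 i j; rewrite summxE (bigD1_seq k) //= big1 => [|l lk].
    by rewrite vE ij eqxx mulr1n addr0 mxE.
  by have [v' _ ->] := rep_mon l i; rewrite ij eq_sym (negPf lk).
by rewrite [RHS]big_seq; rewrite big_seq; apply: eq_bigr => k ->.
Qed.

(** The image of [Y^(m-1)] is the matrix unit at [(0, m-1)]. Multiplying by [X^i] on the left and by
    [X^(m-1-j)] on the right moves it to [(i, j)], up to units. *)
Lemma rep_surj (B : 'M[D]_m) : exists w, g w = B.
Proof.
rewrite [B]matrix_sum_delta.
pose P C := exists w, g w = C.
have PD C C' : P C -> P C' -> P (C + C').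
  by move=> [w <-] [w' <-]; exists (w + w'); rewrite rmorphD.
have P0 : P 0 by exists 0; rewrite rmorph0.
apply: (big_ind P) => // i _; apply: (big_ind P) => // j _.
have m0 : (0 < m)%N by case: (m) i => // -[].
have m1 : (m.-1 < m)%N by rewrite prednK.
pose i0 := Ordinal m0; pose i1 := Ordinal m1.
have [v [v' [vv' v'v]] vE] := matX_exp i i.
have [w [w' [ww' w'w]] wE] := matX_exp (m.-1 - j) i1.
(* The inverses [v'] and [w'] cancel the units that the two powers of [matX] introduce. *)
have [a aE] := rq_surj (v' * B i j * w').
exists (gwaX ^+ i * (cst a * gwaY ^+ m.-1) * gwaX ^+ (m.-1 - j)).
rewrite !rmorphM !rmorphXn /= g_cst gX gY.
set C := matX ^+ i * _.
have CE r k : C r k = v * twist 0 a *+ ((r == i) && (k == i1)).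
  rewrite [C r k]mxE (bigD1 i0) //= big1 => [|l li0]; last first.
    rewrite [(diag_twist a * _) _ _]diag_twist_mul matY_exp ltn_eqF ?mulr0 //.
    by have := ltn_ord k; move: li0; rewrite -val_eqE /=; lia.
  rewrite [(diag_twist a * _) _ _]diag_twist_mul matY_exp addr0 add0n mulr_natr mulrnAr.
  have [->|ri] := eqVneq r i; first by rewrite vE eqxx.
  have [vr _ ->] := matX_exp i r.
  by rewrite add0n (negPf (ri : r != i :> nat)) mulr0n mul0r mul0rn.
apply/matrixP => r s; rewrite [LHS]mxE (bigD1 i1) //= big1 => [|l li1]; last first.
  by rewrite CE (negPf li1) andbF mul0r.
rewrite CE eqxx andbT wE addr0 !mxE [twist 0 a](esym aE).
have -> : (m.-1 == s + (m.-1 - j))%N = (s == j).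
  by rewrite -val_eqE /=; have := ltn_ord j; lia.
case: (r == i); last by rewrite mul0r mulr0.
case: (s == j); last by rewrite !mulr0.
by rewrite !mulr1n mulr1 !mulrA vv' mul1r -mulrA w'w mulr1.
Qed.

End Kernel.

End MatrixRepresentation.

Theorem proposition4p8 (A : pzRingType) (alpha : ring_aut A) (u : A)
    (uC : central u) (m : nat) :
  regular u ->
  (0 < m)%N ->
  simple_ring (ring_quot (gwaM alpha uC m)) ->
  right_ore_domain (ring_quot (gwaM alpha uC m)) ->
  (forall i : nat, (0 < i)%N -> i <> m -> two_gen alpha u i = [set: A]) ->
  has_right_goldie_rank (ring_quot (gwaJ alpha uC m)) m.
Proof.
move=> _ _ _ ore u_inv.
have [g [g_cst gX gY]] :=
  gwa_lift (matYX alpha uC m) (matXY alpha uC m)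
    (@matY_diag _ alpha _ uC m) (@matX_diag _ alpha _ uC m).
have [h h_bij] := ring_quot_iso (rep_surj u_inv g_cst gX gY) (rep_kernel u_inv g_cst gX gY).
exact: right_goldie_rank_iso h_bij (right_goldie_rank_matrix m ore).
Qed.
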